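(* Let $\alpha>0$, let $\{y_k\}\subset\mathcal{Y}$ be a sequence with $y_k\to y^\delta$ in $\mathcal{Y}$, and for each $k$ let $x_k\in\mathcal{D}(F)$ be a minimizer over $x\in\mathcal{D}(F)$ of $$\|F(x)-y_k\|_{\mathcal{Y}}^2+\|x-x^*\|_{\mathcal{S},\alpha}^2 .$$ Then $\{x_k\}$ has a convergent subsequence (in the norm of $L^2(\Omega)$), and the limit of every convergent subsequence of $\{x_k\}$ is a minimizer of $$\min_{x\in\mathcal{D}(F)}\left\{\|F(x)-y^\delta\|_{\mathcal{Y}}^2+\|x-x^*\|_{\mathcal{S},\alpha}^2\right\}.$$
   Context: Setting. $\Omega\subset\mathbb{R}^n$ is measurable and bounded, $\mathcal{Y}$ is a Hilbert space, and $F:\mathcal{D}(F)\subset L^2(\Omega)\to\mathcal{Y}$ is a (possibly nonlinear) operator which is continuous and weakly sequentially closed, i.e. if $x_n\in\mathcal{D}(F)$, $x_n\rightharpoonup x$ in $L^2(\Omega)$ and $F(x_n)\rightharpoonup z$ in $\mathcal{Y}$, then $x\in\mathcal{D}(F)$ and $F(x)=z$. $\|\cdot\|_2$ is the $L^2(\Omega)$-norm. $\mathcal{S}\subset\Omega$ is a measurable set; for $x\in L^2(\Omega)$, ''$\mathrm{supp}(x)\subset\mathcal{S}$'' means $x=0$ almost everywhere on $\Omega\setminus\mathcal{S}$. The exact data $y\in\mathcal{Y}$ are such that there is an exact solution $x^\dagger\in\mathcal{D}(F)$ of $F(x^\dagger)=y$ with $\mathrm{supp}(x^\dagger)\subset\mathcal{S}$.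 The initial guess $x^*\in L^2(\Omega)$ satisfies $\mathrm{supp}(x^* )\subset\mathcal{S}$ and is such that $x^\dagger$ minimizes $\|x-x^*\|_2$ among all $x\in\mathcal{D}(F)$ with $F(x)=y$ and $\mathrm{supp}(x)\subset\mathcal{S}$. The noisy data $y^\delta\in\mathcal{Y}$ satisfy $\|y^\delta-y\|_{\mathcal{Y}}\le\delta$. For $\alpha>0$ and $x\in L^2(\Omega)$, define $$\|x\|_{\mathcal{S},\alpha}:=\left(\alpha\int_{\mathcal{S}}|x(\lambda)|^2\,d\lambda+\int_{\Omega\setminus\mathcal{S}}|x(\lambda)|^2\,d\lambda\right)^{1/2}.$$ *)

(* Defs.v *)
From HB Require Import structures.
From mathcomp Require Import all_boot all_order all_algebra.
From mathcomp Require Import sesquilinear generic_quotient.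
From mathcomp Require Import all_classical all_reals all_analysis.
From mathcomp Require Import measurable_realfun ess_sup_inf.

Set Implicit Arguments.
Unset Strict Implicit.
Unset Printing Implicit Defensive.
Import Order.TTheory GRing.Theory Num.Theory.
Import numFieldNormedType.Exports.

Local Open Scope classical_set_scope.
Local Open Scope ring_scope.

Section covering_outer_measure.
Local Open Scope ereal_scope.
Context {R : realType} {T I : Type}.
Variables (B : I -> set T) (v : I -> \bar R).

Definition covering_outer (A : set T) : \bar R :=
  ereal_inf [set \sum_(k <oo) v (F k) |
             F in [set F : nat -> I | A `<=` \bigcup_k B (F k)]].

Hypothesis v_ge0 : forall i, 0 <= v i.

Lemma covering_outer_ge0 A : 0 <= covering_outer A.
Proof.
by apply: le_ereal_inf_tmp => x [F _ <-{x}]; exact: nneseries_ge0.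
Qed.

Lemma le_covering_outer : {homo covering_outer : A C / A `<=` C >-> A <= C}.
Proof.
move=> A C AC; apply/ereal_inf_le_tmp => x [F CF <-{x}].
by exists F => //; exact: subset_trans CF.
Qed.

Lemma covering_outer0 i0 : v i0 = 0 -> covering_outer set0 = 0.
Proof.
move=> v0; apply/eqP; rewrite eq_le covering_outer_ge0 andbT.
apply: ereal_inf_lbound; exists (fun=> i0) => //.
by rewrite eseries0.
Qed.

Lemma covering_outer_sigma_subadditive : sigma_subadditive covering_outer.
Proof.
move=> A; have [[i ioo]|] := pselect (exists i, covering_outer (A i) = +oo).
  rewrite (eseries_pinfty _ _ ioo) ?leey// => n _.
  by rewrite -ltNye (lt_le_trans _ (covering_outer_ge0 _)).
rewrite -forallNE => Aoo.
suff add2e (e : {posnum R}) : covering_outer (\bigcup_n A n) <=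
    \sum_(i <oo) covering_outer (A i) + e%:num%:E.
  by apply/lee_addgt0Pr => _/posnumP[].
rewrite (le_trans _ (epsilon_trick _ _ _))//; last first.
  by move=> n; exact: covering_outer_ge0.
pose P n (F : nat -> I) := A n `<=` \bigcup_k B (F k) /\
  \sum_(k <oo) v (F k) <= covering_outer (A n) + (e%:num / (2 ^ n.+1)%:R)%:E.
have [G PG] : {G : nat -> nat -> I & forall n, P n (G n)}.
  apply: (@choice _ _ P) => n; rewrite /P /covering_outer.
  set S := (X in ereal_inf X); move infS : (ereal_inf S) => iS.
  case: iS infS => [r Sr|Soo|Soo].
  - have en1 : (0 < e%:num / (2 ^ n.+1)%:R)%R by [].
    have /(lb_ereal_inf_adherent en1) : ereal_inf S \is a fin_num by rewrite Sr.
    move=> [x [F AnF vFx] xS].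
    by exists F; split => //; rewrite vFx -Sr; exact/ltW.
  - by have := Aoo n; rewrite /covering_outer Soo.
  - suff : lbound S 0 by move/le_ereal_inf_tmp; rewrite Soo.
    by move=> /= _ [F _ <-]; exact: nneseries_ge0.
have vG_ge0 x : 0 <= (v \o uncurry G) x by exact: v_ge0.
apply: (@le_trans _ _ (\esum_(i in setT) (v \o uncurry G) i)).
  apply: ereal_inf_lbound => /=.
  have /card_esym/ppcard_eqP[f] := card_nat2.
  exists (uncurry G \o f).
    move=> t [i _ /(PG i).1 [j _ Bijt]]; exists (f^-1%FUN (i, j)) => //=.
    by rewrite invK ?inE.
  rewrite -(esum_pred_image (v \o uncurry G) _ xpredT) ?[fun=> _]set_true//.
  by rewrite image_eq.
rewrite (_ : esum _ _ = \sum_(i <oo) \sum_(j <oo ) v (G i j)); last first.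
  pose J : nat -> set (nat * nat) := fun i => [set (i, j) | j in setT].
  rewrite (_ : setT = \bigcup_k J k); last first.
    by rewrite predeqE => -[a b]; split => // _; exists a => //; exists b.
  rewrite esum_bigcupT /=; last 2 first.
    - apply/trivIsetP => i j _ _ ij.
      rewrite predeqE => -[n m] /=; split => //= -[] [_] _ [<-{n} _].
      by move=> [m' _] [] /esym/eqP; rewrite (negbTE ij).
    - by move=> /= [n m]; exact: v_ge0.
  rewrite -(image_id [set: nat]) -fun_true esum_pred_image//; last first.
    by move=> n _; exact: esum_ge0.
  apply: eq_eseriesr => /= j _.
  rewrite -(esum_pred_image (v \o uncurry G) (pair j) predT)//=; last first.
    by move=> ? ? _ _; exact: (@can_inj _ _ _ snd).
  by congr esum; rewrite predeqE => -[a b]; split; move=> [i _ <-]; exists i.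
apply: lee_lim.
- apply: is_cvg_nneseries => n *.
  by apply: nneseries_ge0 => m *; exact: (vG_ge0 (n, m)).
- by apply: is_cvg_nneseries => n *; apply: adde_ge0 => //; exact: covering_outer_ge0.
- by near=> n; apply: lee_sum => i _; exact: (PG i).2.
Unshelve. all: by end_near. Qed.

End covering_outer_measure.

Section lebesgue_Rn.
Context {R : realType} {n : nat}.

(* [None] is the empty box; it is needed in dimension 0, where the volume of
   every [Some] box is the empty product. *)
Definition box (p : option ('rV[R]_n * 'rV[R]_n)) : set 'rV[R]_n :=
  if p is Some (a, b) then [set t | forall i, a ord0 i <= t ord0 i <= b ord0 i]
  else set0.

Definition box_volume (p : option ('rV[R]_n * 'rV[R]_n)) : \bar R :=
  if p is Some (a, b) then (\prod_i Num.max 0 (b ord0 i - a ord0 i))%:E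
  else 0%E.

Definition lebesgue_outer : set 'rV[R]_n -> \bar R :=
  covering_outer box box_volume.

Lemma box_volume_ge0 p : (0 <= box_volume p)%E.
Proof.
case: p => [[a b]|]//=; rewrite lee_fin prodr_ge0// => i _.
by rewrite le_max lexx.
Qed.

HB.instance Definition _ := isOuterMeasure.Build R 'rV[R]_n lebesgue_outer
  (covering_outer0 box box_volume_ge0 (i0 := None) erefl)
  (covering_outer_ge0 box box_volume_ge0)
  (@le_covering_outer _ _ _ box box_volume)
  (covering_outer_sigma_subadditive box box_volume_ge0).

End lebesgue_Rn.
Arguments lebesgue_outer R n : clear implicits.

(* The Caratheodory-measurable sets of the outer measure are the Lebesgue
   measurable sets, so this is R^n with its complete Lebesgue sigma-algebra. *)
Notation Rn R n := (caratheodory_type (lebesgue_outer R n)).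

Definition lebesgue (R : realType) (n : nat) : {measure set (Rn R n) -> \bar R} :=
  OuterMeasure.sort (lebesgue_outer R n : {outer_measure set 'rV[R]_n -> \bar R}).

Section Lspace_normedModType.
Context d (T : measurableType d) (R : realType).
Variables (mu : {measure set T -> \bar R}) (p : \bar R) (p1 : (1 <= p)%E).
Notation V := (LspaceType mu p1).
Notation W := (LfunType mu p1).
Implicit Types (x y z : V) (f g h : W).

Lemma ae_eq_Lnorm (f g : T -> \bar R) : measurable_fun setT f ->
  measurable_fun setT g -> f = g %[ae mu] -> ('N[mu]_p[f] = 'N[mu]_p[g])%E.
Proof.
move=> mf mg fg; rewrite unlock; case: p p1 => [r|_|//] /=.
  move=> r1; congr (_ `^ _)%E; apply: ge0_ae_eq_integral => //.
  - by apply: (@measurableT_comp _ _ _ _ _ _ (@poweR R ^~ r)) => //;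
      [exact: measurable_poweR | exact: measurableT_comp].
  - by apply: (@measurableT_comp _ _ _ _ _ _ (@poweR R ^~ r)) => //;
      [exact: measurable_poweR | exact: measurableT_comp].
  - by move=> x _; exact: poweR_ge0.
  - by move=> x _; exact: poweR_ge0.
  - by move: fg; apply: filterS => t /[apply] ->.
case: ifPn => // _; apply: eq_ess_sup.
by move: fg; apply: filterS => t /(_ I) /= ->.
Qed.

Lemma Lspace_Lfun x : (x : T -> R) \in Lfun mu p.
Proof.
apply/andP; split; rewrite inE /=.
  exact: (@measurable_funPT _ _ _ _ (repr (x : {mfun_ mu, T >-> measurableTypeR R}))).
exact: (@Lebesgue_finite _ _ _ _ _ p1 x).
Qed.

(* A chosen representative of x; it is determined only almost everywhere. *)
Definition Lrepr x : W := Lfun_Sub p1 (Lspace_Lfun x).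
Arguments Lrepr : simpl never.

Let Lmfun f : {mfun T >-> measurableTypeR R} :=
  mfun_Sub (mem_set (@measurable_funPT _ _ _ _ f) : (f : T -> measurableTypeR R) \in mfun).

Let Lclass_mfun f : {mfun_ mu, T >-> measurableTypeR R} :=
  \pi_({mfun_ mu, T >-> measurableTypeR R})%qT (Lmfun f).

Let Lclass_mfunK f : (Lclass_mfun f : T -> R) = f %[ae mu].
Proof.
have : \pi_({mfun_ mu, T >-> measurableTypeR R})%qT (repr (Lclass_mfun f)) =
    \pi_({mfun_ mu, T >-> measurableTypeR R})%qT (Lmfun f) by rewrite reprK.
by move/eqmodP => /asboolP.
Qed.

Let Lclass_finite f : finite_norm mu p (Lclass_mfun f).
Proof.
rewrite /finite_norm (@ae_eq_Lnorm _ (EFin \o f)).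
- exact: Lfunction_finite.
- apply/measurable_EFinP.
  exact: (@measurable_funPT _ _ _ _ (repr (Lclass_mfun f))).
- by apply/measurable_EFinP; exact: (@measurable_funPT _ _ _ _ f).
- exact: ae_eq_comp (Lclass_mfunK f).
Qed.

Definition Lclass f : V :=
  LebesgueSpace.Pack (LebesgueSpace.Class
    (isFinLebesgue.Build _ _ _ mu p p1 (Lclass_mfun f) (Lclass_finite f))).

Lemma LclassK f : Lrepr (Lclass f) = f %[ae mu].
Proof. exact: Lclass_mfunK. Qed.

Lemma Lspace_eqP x y : x = y <-> Lrepr x = Lrepr y %[ae mu].
Proof.
split=> [->|]; first exact/ae_eq_refl.
case: x => x [[xf]]; case: y => y [[yf]] /= xy.
have {}xy : x = y.
  rewrite -[x]reprK -[y]reprK; apply/eqmodP/asboolP; exact: xy.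
by case: y / xy yf xf => yf xf; rewrite (Prop_irrelevance xf yf).
Qed.

Lemma Lclass_eqP f g : Lclass f = Lclass g <-> f = g %[ae mu].
Proof.
rewrite Lspace_eqP; split=> fg.
- by apply: ae_eq_trans (LclassK g); apply: ae_eq_trans fg; apply/ae_eq_sym/LclassK.
- by apply: ae_eq_trans (LclassK f) _; apply: ae_eq_trans fg _; apply/ae_eq_sym/LclassK.
Qed.

Lemma LreprK : cancel Lrepr Lclass.
Proof. by move=> x; apply/Lspace_eqP; exact: LclassK. Qed.

HB.instance Definition _ := gen_eqMixin V.
HB.instance Definition _ := gen_choiceMixin V.

Let zero := Lclass 0.
Let opp x := Lclass (- Lrepr x).
Let add x y := Lclass (Lrepr x + Lrepr y).
Let scale (a : R) x := Lclass (a *: Lrepr x).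

Let W0 t : (0 : W) t = 0. Proof. by []. Qed.
Let WN f t : (- f) t = - f t. Proof. by []. Qed.
Let WD f g t : (f + g) t = f t + g t. Proof. by []. Qed.
Let WZ (a : R) f t : (a *: f) t = a * f t. Proof. by []. Qed.
Let WE := (W0, WN, WD, WZ).

Let eq_Lclass h1 h2 h3 f g :
  (forall t, Lrepr (Lclass h1) t = h1 t -> Lrepr (Lclass h2) t = h2 t ->
   Lrepr (Lclass h3) t = h3 t -> f t = g t) -> Lclass f = Lclass g.
Proof.
move=> fg; apply/Lclass_eqP; move: (LclassK h1) (LclassK h2) (LclassK h3).
by apply: filterS3 => t /(_ I) ? /(_ I) ? /(_ I) ? _; exact: fg.
Qed.

Let addA : associative add.
Proof.
move=> x y z; apply: (@eq_Lclass (Lrepr x + Lrepr y) (Lrepr y + Lrepr z) 0).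
by move=> t e1 e2 _; rewrite !WE e1 e2 !WE addrA.
Qed.

Let addC : commutative add.
Proof. by move=> x y; rewrite /add addrC. Qed.

Let add0 : left_id zero add.
Proof.
move=> x; rewrite -[RHS]LreprK; apply: (@eq_Lclass 0 0 0) => t e1 _ _.
by rewrite !WE e1 !WE add0r.
Qed.

Let addN : left_inverse zero opp add.
Proof.
move=> x; apply: (@eq_Lclass (- Lrepr x) 0 0) => t e1 _ _.
by rewrite !WE e1 !WE addNr.
Qed.

HB.instance Definition _ := GRing.isZmodule.Build V addA addC add0 addN.

Let scaleA (a b : R) x : scale a (scale b x) = scale (a * b) x.
Proof.
apply: (@eq_Lclass (b *: Lrepr x) 0 0) => t e1 _ _.
by rewrite !WE e1 !WE mulrA.
Qed.

Let scale1 : left_id 1 scale.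
Proof. by move=> x; rewrite /scale scale1r LreprK. Qed.

Let scaleDr : right_distributive scale +%R.
Proof.
move=> a x y.
apply: (@eq_Lclass (Lrepr x + Lrepr y) (a *: Lrepr x) (a *: Lrepr y)).
by move=> t e1 e2 e3; rewrite !WE e1 e2 e3 !WE mulrDr.
Qed.

Let scaleDl x : {morph scale^~ x : a b / a + b}.
Proof.
move=> a b; apply: (@eq_Lclass (a *: Lrepr x) (b *: Lrepr x) 0) => t e1 e2 _.
by rewrite !WE e1 e2 !WE mulrDl.
Qed.

HB.instance Definition _ :=
  GRing.Zmodule_isLmodule.Build R V scaleA scale1 scaleDr scaleDl.

Lemma LreprD x y : Lrepr (x + y) = (Lrepr x + Lrepr y) %[ae mu].
Proof. exact: LclassK. Qed.

Lemma LreprN x : Lrepr (- x) = (- Lrepr x) %[ae mu].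
Proof. exact: LclassK. Qed.

Lemma LreprZ a x : Lrepr (a *: x) = (a *: Lrepr x) %[ae mu].
Proof. exact: LclassK. Qed.

Let norm x : R := fine ('N[mu]_p[EFin \o Lrepr x])%E.

Let norm_Lclass f : norm (Lclass f) = fine ('N[mu]_p[EFin \o f])%E.
Proof.
congr fine; apply: ae_eq_Lnorm; last exact: ae_eq_comp (LclassK f).
- by apply/measurable_EFinP; exact: (@measurable_funPT _ _ _ _ (Lrepr _)).
- by apply/measurable_EFinP; exact: (@measurable_funPT _ _ _ _ f).
Qed.

Let ler_normD x y : norm (x + y) <= norm x + norm y.
Proof. by rewrite norm_Lclass; exact: ler_LnormD. Qed.

Let normrZ a x : norm (a *: x) = `|a| * norm x.
Proof.
rewrite norm_Lclass (LnormZ (Lrepr x) a) fineM//.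
by rewrite -finite_norm_fine.
Qed.

Let normr0_eq0 x : norm x = 0 -> x = 0.
Proof.
move=> /fine_Lnormr_eq0 x0; rewrite -[LHS]LreprK; exact/Lclass_eqP.
Qed.

HB.instance Definition _ :=
  Lmodule_isNormed.Build R V ler_normD normrZ normr0_eq0.

Lemma Lspace_normE x : `|x| = fine ('N[mu]_p[EFin \o Lrepr x])%E.
Proof. by []. Qed.

End Lspace_normedModType.
Arguments Lrepr {d T R mu p p1} x : simpl never.

Definition weak_cvg (R : realType) (V : Type) (dot : V -> V -> R)
    (u : nat -> V) (l : V) : Prop :=
  forall v, (fun k => dot (u k) v) @ \oo --> dot l v.

(* F is total; only its values on the domain D are meaningful. *)
Definition weakly_seq_closed (R : realType) (U V : Type)
    (dotU : U -> U -> R) (dotV : V -> V -> R) (D : set U) (F : U -> V) : Prop :=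
  forall (u : nat -> U) (x : U) (z : V), (forall k, D (u k)) ->
    weak_cvg dotU u x -> weak_cvg dotV (F \o u) z -> D x /\ F x = z.

Definition minimizes_on (R : realType) (U : Type) (D : set U) (J : U -> R)
    (x : U) : Prop :=
  D x /\ forall x', D x' -> J x <= J x'.

Section L2_Omega.
Context {R : realType} {n : nat} {Omega : set (Rn R n)}.
Variable mOmega : measurable Omega.

(* Functions on R^n up to equality almost everywhere on Omega, with norm the
   square root of the integral over Omega of the square. *)
Definition L2 := LspaceType2 (mrestr (lebesgue R n) mOmega).

HB.instance Definition _ := NormedModule.on L2.

Implicit Types (x z : L2) (S : set (Rn R n)).

Definition L2_dot x z : R :=
  \int[lebesgue R n]_(t in Omega) (Lrepr x t * Lrepr z t).

Definition supported_in S x : Prop :=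
  {ae lebesgue R n, forall t, (Omega `\` S) t -> Lrepr x t = 0}.

Definition weighted_norm S (alpha : R) x : R :=
  Num.sqrt (alpha * \int[lebesgue R n]_(t in S) `|Lrepr x t| ^+ 2
            + \int[lebesgue R n]_(t in Omega `\` S) `|Lrepr x t| ^+ 2).

Definition tikhonov (Y : normedModType R) (F : L2 -> Y) (xstar : L2)
    S (alpha : R) (w : Y) x : R :=
  `|F x - w| ^+ 2 + weighted_norm S alpha (x - xstar) ^+ 2.

End L2_Omega.

(* Main.v *)
Require Import Defs.
From HB Require Import structures.
From mathcomp Require Import all_boot all_order all_algebra.
From mathcomp Require Import sesquilinear.
From mathcomp Require Import all_classical all_reals all_analysis.
From mathcomp Require Import ring lra measurable_realfun.

(** Both claims follow from one statement about a Tikhonov functional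
    J_w(x) = |F x - w|^2 + q(x - xs) on Hilbert spaces, where q is a quadratic
    form with c |x|^2 <= q x for some c > 0 ([tikhonov_stability]).  Comparing
    the minimizers x_k with one fixed point bounds x_k and F x_k; bounded
    sequences have weakly convergent subsequences ([bounded_weak_subseq]), so
    along a subsequence x_k tends weakly to x and F x_k tends weakly to z, and
    weak closedness gives F x = z.  Expanding the squares around the weak limit
    gives
      J_{y_k}(x_k) = J_yd(x) + q(x_k - x) + |eta_k|^2 + r_k,   r_k --> 0,
    with eta_k = (F x_k - y_k) - (F x - yd), since the cross terms are inner
    products of fixed vectors with weakly null sequences.  As
    J_{y_k}(x_k) <= J_{y_k}(x') --> J_yd(x'), the point x is a minimizer, and
    the choice x' = x forces q(x_k - x) --> 0, which is strong convergence.

    Hence every subsequence of (x_k) has a further subsequence that converges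
    in norm to a minimizer.  This is the first claim, and it identifies the
    limit of any convergent subsequence by uniqueness of limits.

    Weak compactness comes from ultrafilters.  Along an ultrafilter every
    bounded sequence has a weak limit, because the limits of its inner products
    form a bounded linear functional, represented by a vector
    ([riesz_representation]).  A subsequence is then selected on which the inner
    products with the countably many terms of the sequence itself converge; all
    ultrafilters finer than the filter of tails give it the same weak limit.

    The remaining work is to present L^2(Omega) as a Hilbert space.
    Completeness ([Lspace2_complete]) is the Riesz-Fischer argument, and the
    weighted norm is a quadratic form of the required kind because it is the
    form of multiplication by the bounded weight equal to alpha on S and to 1
    off S. *)

Set Implicit Arguments.
Unset Strict Implicit.
Unset Printing Implicit Defensive.
Import Order.TTheory GRing.Theory Num.Theory.
Import numFieldNormedType.Exports.

Local Open Scope classical_set_scope.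
Local Open Scope ring_scope.

(** * Ultrafilters and subsequences *)

Lemma bounded_ultra_cvg (R : realType) (T : Type) (U : set_system T)
    (f : T -> R) (M : R) :
  UltraFilter U -> (forall i, `|f i| <= M) -> exists l : R, f @ U --> l.
Proof.
move=> UU fM.
have PU : ProperFilter (f @ U) by exact: fmap_proper_filter.
have UM : (f @ U) [set` `[- M, M]].
  apply: (@filterE _ U) => i; rewrite /= in_itv /= -ler_norml.
  exact: fM.
have [l [_ cl]] := @segment_compact R (- M) M _ PU UM.
exists l => B Bl; have [//|UnB] := in_ultra_setVsetC (f @^-1` B) UU.
by have [x [/= nBx Bx]] := cl (~` B) B UnB Bl.
Qed.

(** If the preimage of a neighbourhood of [l] were not in [F], some ultrafilter
    finer than [F] would contain its complement. *)
Lemma cvg_of_ultra (R : realType) (T : Type) (F : set_system T)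
    (f : T -> R) (l : R) : ProperFilter F ->
  (forall U, UltraFilter U -> F `<=` U -> f @ U --> l) -> f @ F --> l.
Proof.
move=> FF fU B Bl; apply: contrapT => nFB.
have WF : ProperFilter (within (~` (f @^-1` B)) F).
  split=> [F0|]; last exact: (within_filter _ FF).
  apply: nFB; move: F0; rewrite /within /= => F0.
  by apply: filterS F0 => x /= h; apply: contrapT => /h.
have [U [UU WU]] := ultraFilterLemma WF.
have FU : F `<=` U.
  by move=> A FA; apply: WU; apply: filterS FA.
have UB : U (~` (f @^-1` B)) by apply: WU; exact: withinT.
have UB' : U (f @^-1` B) := fU U UU FU B Bl.
by have [x []] := filter_ex (filterI UB UB').
Qed.

Lemma increasing_selection (A : nat -> set nat) :
  (forall m N, exists2 k, (N <= k)%N & A m k) ->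
  exists phi : nat -> nat,
    {homo phi : i j / (i < j)%N} /\ forall m, A m (phi m).
Proof.
move=> AN.
have [g gP] : exists g : nat -> nat -> nat,
    forall m N, (N <= g m N)%N /\ A m (g m N).
  have h m : exists gm : nat -> nat, forall N, (N <= gm N)%N /\ A m (gm N).
    have {}h N : exists k, (N <= k)%N /\ A m k by have [k] := AN m N; exists k.
    by have [f fP] := @choice _ _ (fun N k => (N <= k)%N /\ A m k) h; exists f.
  by have [f fP] := @choice _ _
    (fun m gm => forall N, (N <= gm N)%N /\ A m (gm N)) h; exists f.
pose phi := fix phi m := if m is k.+1 then g k.+1 (phi k).+1 else g 0%N 0%N.
exists phi; split.
  by apply: homo_ltn => [? ? ?|i]; [exact: ltn_trans|exact: (gP i.+1 _).1].
by case=> [|m]; exact: (gP _ _).2.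
Qed.

Lemma increasing_cvgnyy (g : nat -> nat) :
  {homo g : i j / (i < j)%N} -> g @ \oo --> \oo.
Proof.
move=> g_inc A [N _ NA]; exists N => // k /= Nk; apply: NA => /=.
apply: leq_trans Nk _; elim: k => // k ih.
exact: leq_ltn_trans ih (g_inc _ _ (ltnSn k)).
Qed.

(** * Weak compactness in Hilbert spaces *)

Section hilbert.
Context {R : realType} {H : completeNormedModType R}.
Variable dot : {dot H for idfun}.
Hypothesis dot_norm : forall u, dot u u = `|u| ^+ 2.
Implicit Types u v w : H.

Lemma dotC u v : dot u v = dot v u.
Proof. by rewrite hermC expr0 mul1r. Qed.

Lemma dotZl a u v : dot (a *: u) v = a * dot u v.
Proof. exact: linearZl_LR. Qed.

Lemma dotZr a u v : dot u (a *: v) = a * dot u v.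
Proof. exact: (linearZr_LR (s' := GRing.mul)). Qed.

Lemma sqr_normD u v : `|u + v| ^+ 2 = `|u| ^+ 2 + 2 * dot u v + `|v| ^+ 2.
Proof. by rewrite -!dot_norm linearDl !linearDr /= (dotC v u); ring. Qed.

Lemma sqr_normB u v : `|u - v| ^+ 2 = `|u| ^+ 2 - 2 * dot u v + `|v| ^+ 2.
Proof. by rewrite sqr_normD linearNr /= normrN; ring. Qed.

Lemma cauchy_schwarz u v : `|dot u v| <= `|u| * `|v|.
Proof.
have [->|u0] := eqVneq u 0; first by rewrite linear0l !normr0 mul0r.
have [->|v0] := eqVneq v 0; first by rewrite linear0r !normr0 mulr0.
have uv0 : 0 < `|u| * `|v| by rewrite mulr_gt0 // normr_gt0.
have hD := sqr_ge0 (`| `|v| *: u + `|u| *: v|).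
have hB := sqr_ge0 (`| `|v| *: u - `|u| *: v|).
rewrite sqr_normD !normrZ !normr_id dotZl dotZr in hD.
rewrite sqr_normB !normrZ !normr_id dotZl dotZr in hB.
rewrite ler_norml; apply/andP; split.
  rewrite -(ler_pM2l uv0); lra.
rewrite -(ler_pM2l uv0); lra.
Qed.

Lemma dot_cvgl {T : Type} {F : set_system T} {FF : Filter F}
    (f : T -> H) l v :
  f @ F --> l -> dot (f x) v @[x --> F] --> dot l v.
Proof.
move=> fl; apply/cvgrPdist_le => e e0.
have e1 : 0 < e / (`|v| + 1) by rewrite divr_gt0 // ltr_wpDl.
move/cvgrPdist_le : fl => /(_ _ e1); apply: filterS => x lx.
rewrite -linearBl (le_trans (cauchy_schwarz _ _)) //.
rewrite (le_trans (ler_wpM2r _ lx)) // mulrAC ler_pdivrMr ?ltr_wpDl //.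
by rewrite ler_wpM2l ?lerDl ?ltW.
Qed.

(** The representing vector minimizes J v = |v|^2 - 2 l v.  By the parallelogram
    identity minimizing sequences are Cauchy, and stationarity of J at their
    limit z says that <z, v> = l v for every v. *)
Lemma riesz_representation (l : H -> R) (M : R) :
  {morph l : u v / u + v} -> (forall a u, l (a *: u) = a * l u) ->
  (forall u, `|l u| <= M * `|u|) -> exists z, forall v, dot z v = l v.
Proof.
move=> lD lZ lM.
pose J v : R := `|v| ^+ 2 - 2 * l v.
have J_lb v : - M ^+ 2 <= J v.
  have := lM v; have := sqr_ge0 (`|v| - M); rewrite ler_norml /J => h /andP[_ h'].
  by nra.
have EJ : has_inf (range J).
  by split; [exists (J 0), 0|exists (- M ^+ 2) => _ [v _ <-]].
set m := inf (range J).
have mJ v : m <= J v by apply: ge_inf => //; exact: EJ.2.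
have [v_ v_m] : {v_ : nat -> H & forall k, J (v_ k) < m + k.+1%:R^-1}.
  apply: (@choice _ _ (fun k v => J v < m + k.+1%:R^-1)) => k.
  have k0 : (0 : R) < k.+1%:R^-1 by rewrite invr_gt0.
  by have [_ [v _ <-] Jv] := inf_adherent k0 EJ; exists v.
(* The linear terms cancel in the parallelogram identity. *)
have par u v : `|u - v| ^+ 2 = 2 * J u + 2 * J v - 4 * J (2^-1 *: (u + v)).
  rewrite /J lZ lD normrZ exprMn sqr_normB sqr_normD ger0_norm ?invr_ge0 //.
  by field.
have vij i j : (i <= j)%N -> `|v_ i - v_ j| ^+ 2 <= 4 * i.+1%:R^-1.
  move=> ij; rewrite par.
  have := mJ (2^-1 *: (v_ i + v_ j)); have := v_m i; have := v_m j.
  have : (j.+1%:R^-1 : R) <= i.+1%:R^-1.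
    by rewrite lef_pV2 ?posrE // ler_nat.
  move: (J _) (J _) (J _) (i.+1%:R^-1) (j.+1%:R^-1) => *; lra.
have : cvg (v_ @ \oo).
  apply: cauchy_cvg; apply: cauchy_exP => e e0.
  have : (fun k => k.+1%:R^-1 : R) @ \oo --> (0 : R) by exact: cvg_harmonic.
  have e4 : 0 < e ^+ 2 / 8 by rewrite divr_gt0 // exprn_gt0.
  move=> /cvgrPdist_lt /(_ _ e4) [N _ Nh].
  exists (v_ N); exists N => // k /= Nk; rewrite -ball_normE /=.
  have := Nh N (leqnn N); rewrite /= sub0r normrN ger0_norm ?invr_ge0 // => hN.
  rewrite -(@ltr_pXn2r _ 2) ?nnegrE ?normr_ge0 ?(ltW e0) //.
  apply: le_lt_trans (vij _ _ Nk) _; move: hN (exprn_gt0 2 e0).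
  move: (N.+1%:R^-1) (e ^+ 2) => *; lra.
move=> /cvg_ex [z vz]; exists z => v.
(* J (v_ k + t v) >= m > J (v_ k) - 1/(k+1), in the limit k --> oo *)
have Jt t : 0 <= 2 * t * (dot z v - l v) + t ^+ 2 * `|v| ^+ 2.
  have h k : 0 <= 2 * t * (dot (v_ k) v - l v) + t ^+ 2 * `|v| ^+ 2 + k.+1%:R^-1.
    have := mJ (v_ k + t *: v); have := v_m k.
    rewrite /J sqr_normD dotZr normrZ exprMn real_normK ?num_real // lD lZ.
    move: (k.+1%:R^-1) (dot _ _) (l _) (l _) (`|v_ k|) (`|v|) => *; lra.
  have : (fun k => 2 * t * (dot (v_ k) v - l v) + t ^+ 2 * `|v| ^+ 2 + k.+1%:R^-1)
      @ \oo --> 2 * t * (dot z v - l v) + t ^+ 2 * `|v| ^+ 2 + 0.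
    apply: cvgD; last exact: cvg_harmonic.
    apply: cvgD; last exact: cvg_cst.
    apply: cvgM; first exact: cvg_cst.
    by apply: cvgB; [exact: dot_cvgl|exact: cvg_cst].
  rewrite addr0 => cv; have <- := cvg_lim _ cv => //.
  by apply: limr_ge; [apply/cvg_ex; eexists; exact: cv|exact: nearW].
apply/eqP; rewrite -subr_eq0; set g := dot z v - l v; apply/eqP.
have N0 : 0 <= `|v| ^+ 2 by rewrite sqr_ge0.
set N := `|v| ^+ 2 in Jt N0 *.
(* t = - g / N would be the optimal step; N + 1 avoids dividing by zero. *)
have := Jt (- g / (N + 1)); rewrite -/g.
have -> : 2 * (- g / (N + 1)) * g + (- g / (N + 1)) ^+ 2 * N =
    - (g ^+ 2 * (N + 2)) / (N + 1) ^+ 2.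
  by field; rewrite gt_eqF // ltr_wpDl.
rewrite pmulr_lge0 ?invr_gt0 ?exprn_gt0 ?ltr_wpDl // => h.
have g2 := sqr_ge0 g.
by apply/eqP; rewrite -sqrf_eq0; apply/eqP; nra.
Qed.

(** For each [v] the bounded numbers <u i, v> have a limit along [U], which is
    linear and bounded in [v]. *)
Lemma weak_ultra_cvg (T : Type) (U : set_system T) (u : T -> H) (M : R) :
  UltraFilter U -> (forall i, `|u i| <= M) ->
  exists z, forall v, dot (u i) v @[i --> U] --> dot z v.
Proof.
move=> UU uM.
have uv v i : `|dot (u i) v| <= M * `|v|.
  by rewrite (le_trans (cauchy_schwarz _ _)) // ler_wpM2r.
have [l lP] : {l : H -> R & forall v, dot (u i) v @[i --> U] --> l v}.
  apply: (@choice _ _ (fun v r => dot (u i) v @[i --> U] --> r)) => v.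
  exact: bounded_ultra_cvg (uv v).
have uniq v r : dot (u i) v @[i --> U] --> r -> l v = r.
  by move=> ur; exact: norm_cvg_unique (lP v) ur.
have [|||z zP] := @riesz_representation l M.
- move=> v w; apply: uniq; under eq_fun do rewrite linearDr.
  by apply: cvgD; exact: lP.
- move=> a v; apply: uniq; under eq_fun do rewrite dotZr.
  by apply: cvgM; [exact: cvg_cst|exact: lP].
- move=> v; have lv : `|dot (u i) v| @[i --> U] --> `|l v| by apply: cvg_norm; exact: lP.
  have <- := cvg_lim _ lv => //.
  by apply: limr_le; [apply/cvg_ex; eexists; exact: lv|exact: nearW].
by exists z => v; rewrite zP; exact: lP.
Qed.

(** Let z be the weak limit along some ultrafilter finer than \oo, and select [phi] so that
    <u (phi m), u j> tends to <z, u j> for every j.  If z' is the weak limit of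
    u o phi along any such ultrafilter, then z' - z is orthogonal to every u j,
    hence to z and z', which are weak limits of such vectors.  So z' = z, and
    u o phi converges weakly. *)
Lemma bounded_weak_subseq (u : nat -> H) (M : R) :
  (forall k, `|u k| <= M) ->
  exists (phi : nat -> nat) (z : H),
    {homo phi : i j / (i < j)%N} /\ weak_cvg dot (u \o phi) z.
Proof.
move=> uM.
have [U [UU ooU]] := @ultraFilterLemma _ (\oo : set_system nat) _.
have FU : Filter U := @ultra_proper _ _ UU.
have [z uz] := weak_ultra_cvg UU uM.
pose A m : set nat :=
  [set k | forall j, (j < m)%N -> `|dot z (u j) - dot (u k) (u j)| <= m.+1%:R^-1].
have [|phi [phi_inc phiA]] := @increasing_selection A.
  move=> m N; suff : U ([set k | (N <= k)%N] `&` A m).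
    by move=> /filter_ex [k [? ?]]; exists k.
  apply: filterI; first by apply: ooU; exact: nbhs_infty_ge.
  have UA (j : 'I_m) : U [set k | `|dot z (u j) - dot (u k) (u j)| <= m.+1%:R^-1].
    by have /cvgrPdist_le := uz (u j); apply.
  have UA' : U (fun k => forall j : 'I_m,
      `|dot z (u j) - dot (u k) (u j)| <= m.+1%:R^-1) := filter_forall FU UA.
  by apply: filterS UA' => k /= h j jm; exact: (h (Ordinal jm)).
exists phi, z; split => // v.
apply: cvg_of_ultra => V VV ooV.
have [|z' uz'] := weak_ultra_cvg VV (u := u \o phi) (M := M).
  by move=> i; exact: uM.
have zz' j : dot z' (u j) = dot z (u j).
  apply: (norm_cvg_unique (uz' (u j))).
  suff h : dot (u (phi k)) (u j) @[k --> \oo] --> dot z (u j).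
    by move=> B Bz; exact: ooV (h B Bz).
  apply/cvgrPdist_le => e e0.
  have /cvgrPdist_lt /(_ _ e0) := @cvg_harmonic R.
  move=> /filterI /(_ (nbhs_infty_gt j)); apply: filterS => k /= [he jk].
  apply: le_trans (phiA k j jk) _; apply/ltW; apply: le_lt_trans he.
  by rewrite sub0r normrN ler_norm.
have w0 j : dot (u j) (z' - z) = 0 by rewrite dotC linearBl /= zz' subrr.
have zw : dot z (z' - z) = 0.
  apply: (norm_cvg_unique (uz (z' - z))) => /=.
  by under eq_fun do rewrite w0; exact: cvg_cst.
have z'w : dot z' (z' - z) = 0.
  apply: (norm_cvg_unique (uz' (z' - z))) => /=.
  by under eq_fun do rewrite /= w0; exact: cvg_cst.
have /eqP : `|z' - z| ^+ 2 = 0 by rewrite -dot_norm linearBl /= z'w zw subrr.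
rewrite expf_eq0 /= normr_eq0 subr_eq0 => /eqP <-; exact: uz'.
Qed.

End hilbert.

(** * Stability of Tikhonov minimizers *)

Lemma cvg_seq_norm_le (R : realType) (V : normedModType R) (u : nat -> V) (l : V) :
  u @ \oo --> l -> exists B, forall k, `|u k| <= B.
Proof.
move=> ul; have : cvgn u by apply/cvg_ex; exists l.
by move=> /cvg_seq_bounded/pinfty_ex_gt0[M _ /= uM]; exists M => k; exact: uM.
Qed.

Section tikhonov.
Context {R : realType} {X Y : completeNormedModType R}.
Variables (dotX : {dot X for idfun}) (dotY : {dot Y for idfun}).
Hypothesis dotX_norm : forall u, dotX u u = `|u| ^+ 2.
Hypothesis dotY_norm : forall u, dotY u u = `|u| ^+ 2.
Variables (D : set X) (F : X -> Y).
Hypothesis F_closed : weakly_seq_closed dotX dotY D F.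
(** The identity [qD] expresses that [q] is the quadratic form of [W]. *)
Variables (q : X -> R) (W : X -> X) (c : R).
Hypothesis qD : forall a x, q (a + x) = q a + 2 * dotX x (W a) + q x.
Hypothesis c_gt0 : 0 < c.
Hypothesis q_coercive : forall x, c * `|x| ^+ 2 <= q x.
Variable xs : X.

(** The limit is first a weak limit; the convergence of the minimal values
    J_{y_k}(x_k) --> J_yd(x) makes it strong, because the defect is
    q(x_k - x) + |eta_k|^2 up to a null sequence. *)
Lemma tikhonov_stability (y_ : nat -> Y) (yd : Y) (x_ : nat -> X) :
  y_ @ \oo --> yd ->
  (forall k, minimizes_on D (fun x => `|F x - y_ k| ^+ 2 + q (x - xs)) (x_ k)) ->
  exists (phi : nat -> nat) (x : X),
    [/\ {homo phi : i j / (i < j)%N}, (x_ \o phi) @ \oo --> x &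
        minimizes_on D (fun x => `|F x - yd| ^+ 2 + q (x - xs)) x].
Proof.
move=> y_cvg x_min; pose J w x : R := `|F x - w| ^+ 2 + q (x - xs).
have q_ge0 x : 0 <= q x.
  by apply: le_trans (q_coercive x); rewrite mulr_ge0 ?sqr_ge0 ?ltW.
have [B yB] := cvg_seq_norm_le y_cvg.
have Dx_ k : D (x_ k) := (x_min k).1.
pose C := (`|F (x_ 0%N)| + B) ^+ 2 + q (x_ 0%N - xs).
have JC k : J (y_ k) (x_ k) <= C.
  apply: le_trans ((x_min k).2 _ (Dx_ 0%N)) _; rewrite lerD2r.
  rewrite lerXn2r ?nnegrE ?addr_ge0 ?(le_trans _ (yB 0%N)) //.
  by rewrite (le_trans (ler_normB _ _)) // lerD2l.
have le_sqr (a b : R) : a ^+ 2 <= b -> a <= b + 1.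
  by move=> ab; have := sqr_ge0 (a - 2^-1); lra.
have x_bd k : `|x_ k| <= C / c + 1 + `|xs|.
  rewrite -[x_ k](subrK xs) (le_trans (ler_normD _ _)) // lerD2r.
  apply: le_sqr; rewrite ler_pdivlMr // mulrC (le_trans (q_coercive _)) //.
  by rewrite (le_trans _ (JC k)) // /J lerDr sqr_ge0.
have F_bd k : `|F (x_ k)| <= C + 1 + B.
  rewrite -[F (x_ k)](subrK (y_ k)) (le_trans (ler_normD _ _)) // lerD //.
  by apply: le_sqr; rewrite (le_trans _ (JC k)) // /J lerDl.
have [f [x [f_inc fx]]] := bounded_weak_subseq dotX_norm x_bd.
have [g [z [g_inc gz]]] := bounded_weak_subseq dotY_norm (fun k => F_bd (f k)).
pose phi := f \o g; exists phi, x.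
have phi_inc : {homo phi : i j / (i < j)%N} by move=> i j /g_inc /f_inc.
have wx : weak_cvg dotX (x_ \o phi) x.
  by move=> v; apply: cvg_comp (increasing_cvgnyy g_inc) (fx v).
have [Dx Fx] : D x /\ F x = z.
  by apply: (F_closed (u := x_ \o phi)) => // k; exact: Dx_.
have yphi : (y_ \o phi) @ \oo --> yd.
  exact: cvg_comp (increasing_cvgnyy phi_inc) y_cvg.
(* eta is the deviation of the residual from its weak limit, and r collects the
   cross terms in the expansion of the functional around that limit. *)
pose eta k := (F (x_ (phi k)) - y_ (phi k)) - (F x - yd).
pose r k := 2 * dotX (x_ (phi k) - x) (W (x - xs)) + 2 * dotY (F x - yd) (eta k).
have r0 : r @ \oo --> 0.
  rewrite -[0]addr0 -[0](mulr0 2); apply: cvgD; apply: cvgM (cvg_cst _) _.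
    under eq_fun do rewrite linearBl.
    by apply/subr_cvg0; exact: wx.
  have etaE k : dotY (F x - yd) (eta k) = (dotY (F (x_ (phi k))) (F x - yd)
      - dotY z (F x - yd)) - (dotY (y_ (phi k)) (F x - yd) - dotY yd (F x - yd)).
    by rewrite (dotC dotY) /eta !linearBl /= Fx; ring.
  under eq_fun do rewrite etaE.
  rewrite -[0](subrr 0); apply: cvgB; apply/subr_cvg0; first exact: gz.
  exact: (dot_cvgl dotY_norm yphi).
have expand k : J (y_ (phi k)) (x_ (phi k)) =
    J yd x + r k + (q (x_ (phi k) - x) + `|eta k| ^+ 2).
  rewrite /J /r.
  have -> : x_ (phi k) - xs = (x - xs) + (x_ (phi k) - x).
    by rewrite [RHS]addrC subrKA.
  have -> : F (x_ (phi k)) - y_ (phi k) = (F x - yd) + eta k.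
    by rewrite /eta [RHS]addrC subrK.
  by rewrite qD (sqr_normD dotY_norm); ring.
have compare x' k : D x' -> J yd x + (q (x_ (phi k) - x) + `|eta k| ^+ 2) <=
    J (y_ (phi k)) x' - r k.
  move=> Dx'; have := (x_min (phi k)).2 _ Dx'; rewrite -/(J _ _) -/(J _ _) expand.
  lra.
have J_cvg x' : J (y_ (phi k)) x' - r k @[k --> \oo] --> J yd x'.
  rewrite -[J yd x']subr0; apply: cvgB => //; apply: cvgD; last exact: cvg_cst.
  have h : `|F x' - y_ (phi k)| @[k --> \oo] --> `|F x' - yd|.
    by apply: cvg_norm; apply: cvgB => //; exact: cvg_cst.
  by rewrite expr2; under eq_fun do rewrite expr2; exact: cvgM.
split=> //; last first.
  split=> // x' Dx'; rewrite -/(J _ _) -/(J _ _) -(cvg_lim _ (J_cvg x')) //.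
  apply: limr_ge; first by apply/cvg_ex; eexists; exact: J_cvg.
  apply: nearW => k; apply: le_trans (compare x' k Dx').
  by rewrite lerDl addr_ge0 ?sqr_ge0.
apply/cvgrPdist_lt => e e0.
have ce : 0 < c * e ^+ 2 by rewrite mulr_gt0 // exprn_gt0.
move/cvgrPdist_lt : (J_cvg x) => /(_ _ ce); apply: filterS => k.
rewrite distrC => /(le_lt_trans (ler_norm _)) h.
rewrite distrC -(@ltr_pXn2r _ 2) ?nnegrE ?normr_ge0 ?(ltW e0) // -(ltr_pM2l c_gt0).
apply: le_lt_trans (q_coercive _) _ => /=.
have := compare x k Dx; have := sqr_ge0 `|eta k|; lra.
Qed.

End tikhonov.

(** * Real-valued integrals *)

Section Rintegral_facts.
Context d (T : measurableType d) (R : realType) (mu : {measure set T -> \bar R}).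

Lemma ae_eq_Rintegral (f g : T -> R) :
  measurable_fun [set: T] f -> measurable_fun [set: T] g ->
  f = g %[ae mu] -> \int[mu]_t f t = \int[mu]_t g t.
Proof.
move=> mf mg fg; congr fine; apply: ae_eq_integral => //; try exact/measurable_EFinP.
by apply: filterS fg => t /= h _; rewrite h.
Qed.

Lemma Rintegral_mrestr (D : set T) (mD : measurable D) (f : T -> R) :
  (mrestr mu mD).-integrable [set: T] (EFin \o f) ->
  \int[mu]_(t in D) f t = \int[mrestr mu mD]_t f t.
Proof.
move=> intf; congr fine.
rewrite (@eq_measure_integral _ _ _ D (mrestr mu mD)); last first.
  by move=> A mA AD; rewrite /= /mrestr setIidl.
rewrite [RHS](@negligible_integral _ _ _ _ _ (~` D)) //.
- by rewrite setTD setCK.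
- exact: measurableC.
- by rewrite /= /mrestr setICl measure0.
Qed.

End Rintegral_facts.

(** * Completeness of square integrable functions *)

(** The increments are at most (B + 1) / 4^k in absolute value. *)
Lemma geometric_increments_cvg (R : realType) (a : nat -> R) (B : R) :
  (forall k, 16 ^+ k * (a k.+1 - a k) ^+ 2 <= B) -> cvgn a.
Proof.
move=> aB; suff : cvgn (series (telescope a)).
  rewrite telescopeK => /cvg_ex[l al]; apply/cvg_ex; exists (l + a 0%N).
  have : (fun n => (a n - a 0%N) + a 0%N) @ \oo --> l + a 0%N.
    exact: (cvgD al (cvg_cst (a 0%N))).
  by under eq_fun do rewrite subrK.
apply: normed_cvg; apply: (@series_le_cvg _ _ (geometric (B + 1) 4^-1)) => [n|n|n|].
- exact: normr_ge0.
- rewrite geometric_ge0 ?invr_ge0 // addr_ge0 //.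
  by apply: le_trans (aB 0%N); rewrite mulr_ge0 ?sqr_ge0 ?exprn_ge0.
- rewrite /telescope /= exprVn ler_pdivlMr ?exprn_gt0 //.
  have p16 : (16 : R) ^+ n = (4 ^+ n) ^+ 2.
    by rewrite exprAC; congr (_ ^+ n); ring.
  have := aB n; rewrite p16 -(real_normK (num_real (a n.+1 - a n))) -exprMn.
  move: (4 ^+ n) `|a n.+1 - a n| => p s h.
  by have := sqr_ge0 (p * s - 2^-1); lra.
- by apply: is_cvg_geometric_series; rewrite ger0_norm ?invr_ge0 // invf_lt1 // ltr1n.
Qed.

Lemma limn_einf_le (R : realType) (u : nat -> \bar R) (l : \bar R) :
  (\forall k \near \oo, (u k <= l)%E) -> (limn_einf u <= l)%E.
Proof.
move=> [N _ ul]; rewrite limn_einf_lim; apply: lime_le; first exact: is_cvg_einfs.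
apply: nearW => n; apply: le_trans (ul (n + N)%N (leq_addl _ _)).
by apply: ereal_inf_lbound; exists (n + N)%N => //=; exact: leq_addr.
Qed.

Section Lspace2.
Context d (T : measurableType d) (R : realType) (mu : {measure set T -> \bar R}).
Local Notation V := (LspaceType mu (lee1n 2)).
Implicit Types (x y z : V) (f : T -> R).

Lemma measurable_Lrepr x : measurable_fun [set: T] (Lrepr x).
Proof. exact: (@measurable_funPT _ _ _ _ (Lrepr x)). Qed.

Lemma Lnorm2_sqr f : ('N[mu]_2%:E[EFin \o f] `^ 2 = \int[mu]_t (f t ^+ 2)%:E)%E.
Proof.
rewrite powR_Lnorm ?pnatr_eq0 //; apply: eq_integral => t _ /=.
by rewrite powR_mulrn ?normr_ge0 // real_normK ?num_real.
Qed.

Lemma Lfun2P f : measurable_fun [set: T] f ->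
  (\int[mu]_t (f t ^+ 2)%:E < +oo)%E -> f \in Lfun mu 2%:E.
Proof.
move=> mf f2; apply/andP; split; rewrite inE //= /finite_norm.
by rewrite (@lty_poweRy _ _ 2) // Lnorm2_sqr.
Qed.

Lemma Lspace_sqr_norm x : (`|x| ^+ 2)%:E = (\int[mu]_t (Lrepr x t ^+ 2)%:E)%E.
Proof.
rewrite -Lnorm2_sqr Lspace_normE -(finite_norm_fine (Lrepr x)) poweR_EFin.
by rewrite powR_mulrn ?fine_ge0 ?Lnorm_ge0.
Qed.

Lemma Lfun_class f : f \in Lfun mu 2%:E -> exists x, Lrepr x = f %[ae mu].
Proof. by move=> fL; exists (Lclass (Lfun_Sub (lee1n 2) fL)); exact: LclassK. Qed.

Lemma Lspace_sqr_dist x y f : f \in Lfun mu 2%:E -> Lrepr y = f %[ae mu] ->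
  (`|x - y| ^+ 2)%:E = (\int[mu]_t ((Lrepr x t - f t) ^+ 2)%:E)%E.
Proof.
move=> fL yf; rewrite Lspace_sqr_norm.
apply: ge0_ae_eq_integral => //.
- by apply/measurable_EFinP; apply: measurable_funX; exact: measurable_Lrepr.
- apply/measurable_EFinP; apply: measurable_funX.
  apply: measurable_funB; first exact: measurable_Lrepr.
  by have /andP[/[!inE]/=] := fL.
- by move=> t _; rewrite lee_fin sqr_ge0.
- by move=> t _; rewrite lee_fin sqr_ge0.
move: (LreprD x (- y)) (LreprN y) yf; apply: filterS3 => t h1 h2 h3 _.
have hD : Lrepr (x - y) t = Lrepr x t + Lrepr (- y) t := h1 I.
have hN : Lrepr (- y) t = - Lrepr y t := h2 I.
by rewrite hD hN h3.
Qed.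

Lemma integrable_Lrepr2 x y :
  mu.-integrable [set: T] (EFin \o (fun t => Lrepr x t * Lrepr y t)).
Proof. by apply/Lfun1_integrable; apply: Lfun2_mul_Lfun1; exact: Lspace_Lfun. Qed.

(** The function 16^k (c_(k+1) - c_k)^2 has integral at most
    16^k (2 / 8^k)^2 = 4 / 4^k, so the series of these functions is finite almost
    everywhere; where it is finite the increments decay like 4^-k. *)
Lemma ae_cvg_Lrepr (c : nat -> V) :
  (forall k, `|c k.+1 - c k| <= 2 * 8^-1 ^+ k) ->
  {ae mu, forall t, cvgn (fun k => Lrepr (c k) t)}.
Proof.
move=> cc.
pose h k t : \bar R := (16 ^+ k * (Lrepr (c k.+1) t - Lrepr (c k) t) ^+ 2)%:E.
have mh k : measurable_fun [set: T] (h k).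
  apply/measurable_EFinP; apply: measurable_funM => //.
  by apply: measurable_funX; apply: measurable_funB; exact: measurable_Lrepr.
have h0 k t : (0 <= h k t)%E.
  by rewrite lee_fin mulr_ge0 ?sqr_ge0 ?exprn_ge0.
have int_h k : (\int[mu]_t h k t <= (8 / (2 ^ (k + 1))%:R)%:E)%E.
  rewrite /h; under eq_integral do rewrite EFinM.
  rewrite ge0_integralZl //; last 2 first.
  - apply/measurable_EFinP; apply: measurable_funX.
    by apply: measurable_funB; exact: measurable_Lrepr.
  - by move=> t _; rewrite lee_fin sqr_ge0.
  rewrite -(Lspace_sqr_dist _ (LfunP (Lrepr (c k))) (ae_eq_refl _ _ _)).
  rewrite -EFinM lee_fin.
  have ck : `|c k.+1 - c k| ^+ 2 <= (2 * 8^-1 ^+ k) ^+ 2.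
    by rewrite lerXn2r ?nnegrE ?mulr_ge0 ?exprn_ge0 ?invr_ge0.
  rewrite (le_trans (ler_wpM2l _ ck)) ?exprn_ge0 // exprMn -exprM mulnC exprM.
  rewrite mulrCA -exprMn (_ : 16 * 8^-1 ^+ 2 = 4^-1 :> R); last by field.
  have -> : 8 / (2 ^ (k + 1))%:R = 2 ^+ 2 * (2 ^+ k)^-1 :> R.
    by rewrite addn1 expnS natrM natrX; field; rewrite expf_neq0.
  rewrite ler_pM2l ?exprn_gt0 // exprVn lef_pV2 ?posrE ?exprn_gt0 //.
  by rewrite lerXn2r ?nnegrE // ler_nat.
have int_sum : (\int[mu]_t (\sum_(k <oo) h k t) < +oo)%E.
  rewrite integral_nneseries //; apply: (@le_lt_trans _ _ 8%:E); last exact: ltry.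
  have /cvg_lim <- // : eseries (fun k => (8 / (2 ^ (k + 1))%:R)%:E) @ \oo --> (8 : R)%:E.
    by rewrite -[8 in X in _ --> X]divr1; exact: (@cvg_geometric_eseries_half _ 8 0).
  apply: lee_nneseries => [k _ _|k _]; last exact: int_h.
  exact: integral_ge0.
have msum : measurable_fun [set: T] (fun t => \sum_(k <oo) h k t)%E.
  exact: ge0_emeasurable_sum.
have : mu.-integrable [set: T] (fun t => \sum_(k <oo) h k t)%E.
  apply/integrableP; split => //; apply: le_lt_trans int_sum.
  apply: ge0_le_integral => //; first exact: measurableT_comp.
  by move=> t _; rewrite gee0_abs // nneseries_ge0.
move=> /integrable_ae => /(_ measurableT); apply: filterS => t /(_ I) ht.
apply: (@geometric_increments_cvg _ _ (fine (\sum_(k <oo) h k t)%E)) => k.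
rewrite -lee_fin fineK //.
apply: le_trans (nneseries_lim_ge k.+1 _) => //.
by rewrite big_nat_recr //= leeDr // sume_ge0.
Qed.

(** The upper limit is measurable also where the sequence diverges, and [fine]
    discards its infinite values. *)
Lemma ae_limit (u : nat -> T -> R) : (forall k, measurable_fun [set: T] (u k)) ->
  {ae mu, forall t, cvgn (u ^~ t)} ->
  exists2 f : T -> R, measurable_fun [set: T] f & {ae mu, forall t, u ^~ t @ \oo --> f t}.
Proof.
move=> mu_ cu; exists (fun t => fine (limn_esup (fun k => (u k t)%:E))).
  apply: measurableT_comp => //; apply: measurable_fun_limn_esup => k.
  exact/measurable_EFinP.
apply: filterS cu => t /cvg_ex[l ul].
have ul' : (u k t)%:E @[k --> \oo] --> l%:E by apply: cvg_EFin => //; exact: nearW.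
by rewrite (cvg_limn_einf_sup ul').2.
Qed.

Lemma fatou_sqr_dist (c : nat -> V) f y (r : R) : measurable_fun [set: T] f ->
  {ae mu, forall t, Lrepr (c k) t @[k --> \oo] --> f t} ->
  (\forall k \near \oo, `|y - c k| ^+ 2 <= r) ->
  (\int[mu]_t ((Lrepr y t - f t) ^+ 2)%:E <= r%:E)%E.
Proof.
move=> mf cf cr; pose g k t := ((Lrepr y t - Lrepr (c k) t) ^+ 2)%:E.
have mg k : measurable_fun [set: T] (g k).
  apply/measurable_EFinP; apply: measurable_funX.
  by apply: measurable_funB; exact: measurable_Lrepr.
have g0 k t : [set: T] t -> (0 <= g k t)%E by rewrite lee_fin sqr_ge0.
have := fatou mu measurableT mg g0.
have -> : (\int[mu]_t limn_einf (g ^~ t) = \int[mu]_t ((Lrepr y t - f t) ^+ 2)%:E)%E.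
  apply: ge0_ae_eq_integral => //.
  - apply: measurableT_comp => //; apply: measurable_fun_limn_esup => k.
    exact: measurableT_comp.
  - apply/measurable_EFinP; apply: measurable_funX.
    by apply: measurable_funB => //; exact: measurable_Lrepr.
  - move=> t _; rewrite limn_einf_lim; apply: lime_ge; first exact: is_cvg_einfs.
    by apply: nearW => k; apply: le_ereal_inf_tmp => _ [m _ <-]; exact: g0.
  - by move=> t _; rewrite lee_fin sqr_ge0.
  apply: filterS cf => t ct _; apply: (cvg_limn_einf_sup _).1.
  apply: cvg_EFin; first exact: nearW.
  by under eq_fun do rewrite /g /= expr2; rewrite expr2;
    apply: cvgM; apply: cvgB => //; exact: cvg_cst.
move=> /le_trans; apply; apply: limn_einf_le.
apply: filterS cr => k; rewrite -lee_fin.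
by rewrite (Lspace_sqr_dist _ (LfunP (Lrepr (c k))) (ae_eq_refl _ _ _)).
Qed.

(** Riesz-Fischer.  Balls of radius 8^-k that belong to the Cauchy filter have
    centres converging so fast that their representatives converge almost
    everywhere; Fatou's lemma shows that the pointwise limit is square
    integrable and is the limit in norm. *)
Lemma Lspace2_complete (F : set_system V) : ProperFilter F -> cauchy F -> cvg F.
Proof.
move=> FF /cauchyP Fc; pose e k : R := 8^-1 ^+ k.
have e_gt0 k : 0 < e k by rewrite exprn_gt0 ?invr_gt0.
have [c cF] : {c : nat -> V & forall k, F (ball (c k) (e k))}.
  by apply: (@choice _ _ (fun k x => F (ball x (e k)))) => k; exact: Fc.
have e_le m k : (m <= k)%N -> e k <= e m.
  move=> mk; rewrite /e !exprVn lef_pV2 ?posrE ?exprn_gt0 //.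
  by rewrite ler_weXn2l // ler1n.
have cc m k : (m <= k)%N -> `|c m - c k| <= 2 * e m.
  move=> mk; have [x []] := filter_ex (filterI (cF m) (cF k)).
  rewrite -!ball_normE /= => xm xk; rewrite -(subrKA x) (le_trans (ler_normD _ _)) //.
  rewrite distrC in xk.
  by have := e_le _ _ mk; lra.
have [f mf cf] : exists2 f : T -> R, measurable_fun [set: T] f &
    {ae mu, forall t, Lrepr (c k) t @[k --> \oo] --> f t}.
  apply: ae_limit; first by move=> k; exact: measurable_Lrepr.
  by apply: ae_cvg_Lrepr => k; rewrite distrC cc.
have near_f m : (\int[mu]_t ((Lrepr (c m) t - f t) ^+ 2)%:E <= ((2 * e m) ^+ 2)%:E)%E.
  apply: fatou_sqr_dist mf cf _; exists m => // k /= mk.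
  by rewrite lerXn2r ?nnegrE ?cc // mulr_ge0 ?ltW.
have fL : f \in Lfun mu 2%:E.
  have gL : (fun t => Lrepr (c 0%N) t - f t) \in Lfun mu 2%:E.
    apply: Lfun2P; last exact: le_lt_trans (near_f 0%N) (ltry _).
    by apply: measurable_funB => //; exact: measurable_Lrepr.
  have -> : f = (Lrepr (c 0%N) - Lfun_Sub (lee1n 2) gL : LfunType mu (lee1n 2)).
    by apply/funext => t; rewrite -[LHS](subKr (Lrepr (c 0%N) t)).
  exact: LfunP.
have [x xf] := Lfun_class fL.
have cx m : `|c m - x| <= 2 * e m.
  rewrite -(@ler_pXn2r _ 2) ?nnegrE ?mulr_ge0 ?(ltW (e_gt0 m)) //.
  by rewrite -lee_fin (Lspace_sqr_dist _ fL xf).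
apply/cvg_ex; exists x; apply/cvgrPdist_lt => r r0.
have : e k @[k --> \oo] --> (0 : R).
  by apply: cvg_expr; rewrite ger0_norm ?invr_ge0 // invf_lt1 // ltr1n.
have r3 : 0 < r / 3 by rewrite divr_gt0.
move=> /cvgrPdist_lt /(_ _ r3) [m _ /(_ m (leqnn m))].
rewrite sub0r normrN gtr0_norm // => em.
apply: filterS (cF m) => y; rewrite -ball_normE /= => cy.
rewrite -(subrKA (c m)) (le_lt_trans (ler_normD _ _)) // distrC.
by have := cx m; lra.
Qed.

(** * Inner product and multiplication operators *)

Definition Lspace_dot x z : R := \int[mu]_t (Lrepr x t * Lrepr z t).

Lemma Lspace_dotC x z : Lspace_dot x z = Lspace_dot z x.
Proof. by apply: eq_Rintegral => t _; rewrite mulrC. Qed.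

Lemma Lspace_dot_linear z : linear_for *%R (Lspace_dot ^~ z).
Proof.
move=> a x y; rewrite /Lspace_dot -RintegralZl //; last exact: integrable_Lrepr2.
rewrite -RintegralD //; last 2 first.
- exact: (integrableZl measurableT a (integrable_Lrepr2 x z)).
- exact: integrable_Lrepr2.
apply: ae_eq_Rintegral.
- by apply: measurable_funM; exact: measurable_Lrepr.
- apply: measurable_funD; [apply: measurable_funM => //|];
    by apply: measurable_funM; exact: measurable_Lrepr.
move: (LreprD (a *: x) y) (LreprZ a x); apply: filterS2 => t h1 h2 _.
have hD : Lrepr (a *: x + y) t = Lrepr (a *: x) t + Lrepr y t := h1 I.
have hZ : Lrepr (a *: x) t = a * Lrepr x t := h2 I.
by rewrite hD hZ; ring.
Qed.

Lemma Lspace_dot_norm x : Lspace_dot x x = `|x| ^+ 2.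
Proof.
rewrite /Lspace_dot /Rintegral -[RHS]/(fine (`|x| ^+ 2)%:E) Lspace_sqr_norm.
by congr fine; apply: eq_integral => t _; rewrite expr2.
Qed.

Lemma bounded_mul_Lfun2 (w : T -> R) (M : R) z :
  measurable_fun [set: T] w -> (forall t, `|w t| <= M) ->
  (fun t => w t * Lrepr z t) \in Lfun mu 2%:E.
Proof.
move=> mw wM.
apply: Lfun2P; first by apply: measurable_funM => //; exact: measurable_Lrepr.
apply: (@le_lt_trans _ _ (\int[mu]_t ((M ^+ 2)%:E * (Lrepr z t ^+ 2)%:E))%E).
  apply: ge0_le_integral => //.
  - by move=> t _; rewrite lee_fin sqr_ge0.
  - apply/measurable_EFinP; apply: measurable_funX.
    by apply: measurable_funM => //; exact: measurable_Lrepr.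
  - apply: measurable_funeM; apply/measurable_EFinP; apply: measurable_funX.
    exact: measurable_Lrepr.
  move=> t _; rewrite -EFinM lee_fin exprMn ler_wpM2r ?sqr_ge0 //.
  by rewrite -(real_normK (num_real (w t))) lerXn2r ?nnegrE // (le_trans _ (wM t)).
rewrite ge0_integralZl ?lee_fin ?sqr_ge0 //; last 2 first.
- by apply/measurable_EFinP; apply: measurable_funX; exact: measurable_Lrepr.
- by move=> t _; rewrite lee_fin sqr_ge0.
by rewrite -Lspace_sqr_norm -EFinM ltry.
Qed.

Lemma integrable_bounded_mul (w : T -> R) (M : R) x z :
  measurable_fun [set: T] w -> (forall t, `|w t| <= M) ->
  mu.-integrable [set: T] (EFin \o (fun t => w t * (Lrepr x t * Lrepr z t))).
Proof.
move=> mw wM; rewrite (_ : (fun _ => _) = (fun t => w t * Lrepr x t) \* Lrepr z).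
  apply/Lfun1_integrable; apply: Lfun2_mul_Lfun1; last exact: LfunP.
  exact: bounded_mul_Lfun2 mw wM.
by apply/funext => t /=; rewrite mulrA.
Qed.

(** [W] is multiplication by [w], which respects classes of functions equal
    almost everywhere. *)
Lemma weight_multiplier (w : T -> R) (M : R) :
  measurable_fun [set: T] w -> (forall t, `|w t| <= M) ->
  exists W : V -> V, forall x z,
    Lspace_dot x (W z) = \int[mu]_t (w t * (Lrepr x t * Lrepr z t)).
Proof.
move=> mw wM.
have [W WE] : {W : V -> V & forall z,
    Lrepr (W z) = (fun t => w t * Lrepr z t) %[ae mu]}.
  apply: (@choice _ _ (fun z y => Lrepr y = (fun t => w t * Lrepr z t) %[ae mu])).
  by move=> z; apply/Lfun_class/bounded_mul_Lfun2.
exists W => x z; apply: ae_eq_Rintegral.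
- by apply: measurable_funM; exact: measurable_Lrepr.
- by do 2 apply: measurable_funM => //; exact: measurable_Lrepr.
by apply: filterS (WE z) => t h _; rewrite h // mulrCA.
Qed.

End Lspace2.

(** * The Hilbert space L2 and its weighted norm *)

Section L2.
Context {R : realType} {n : nat} {Omega : set (Rn R n)} (mOmega : measurable Omega).
Implicit Types x z : L2 mOmega.

Lemma L2_dotE : @L2_dot R n Omega mOmega = @Lspace_dot _ _ _ _.
Proof.
apply/funext => x; apply/funext => z; apply: Rintegral_mrestr.
exact: integrable_Lrepr2.
Qed.

Lemma L2_dot_bilinear : bilinear_for *%R (idfun \; *%R) (@L2_dot R n Omega mOmega).
Proof.
rewrite L2_dotE; split=> z; first exact: Lspace_dot_linear.
by move=> a x y; rewrite !(Lspace_dotC z) Lspace_dot_linear.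
Qed.

HB.instance Definition _ := bilinear_isBilinear.Build _ _ _ _ _ _ _ L2_dot_bilinear.

Lemma L2_dot_symmetric x z : L2_dot x z = (-1) ^+ false * idfun (L2_dot z x).
Proof. by rewrite mul1r L2_dotE Lspace_dotC. Qed.

Lemma L2_dot_norm x : L2_dot x x = `|x| ^+ 2.
Proof. by rewrite L2_dotE Lspace_dot_norm. Qed.

Lemma L2_dot_definite x : x != 0 -> 0 < L2_dot x x.
Proof. by move=> x0; rewrite L2_dot_norm exprn_gt0 // normr_gt0. Qed.

HB.instance Definition _ :=
  isHermitianSesquilinear.Build R (L2 mOmega) false idfun
    (@L2_dot R n Omega mOmega) L2_dot_symmetric.

HB.instance Definition _ :=
  isDotProduct.Build R (L2 mOmega) (@L2_dot R n Omega mOmega) L2_dot_definite.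

HB.instance Definition _ :=
  Uniform_isComplete.Build (L2 mOmega) (@Lspace2_complete _ _ _ _).

(** The integrals in the weighted norm are over subsets of Omega, with respect to
    the Lebesgue measure on the whole space; those of L2 are with respect to its
    restriction to Omega. *)
Lemma Rintegral_setI_sqr x (A : set (Rn R n)) : measurable A ->
  (mrestr (lebesgue R n) mOmega).-integrable [set: Rn R n]
    (EFin \o (fun t => \1_A t * (Lrepr x t * Lrepr x t))) /\
  \int[lebesgue R n]_(t in Omega `&` A) `|Lrepr x t| ^+ 2 =
  \int[mrestr (lebesgue R n) mOmega]_t (\1_A t * (Lrepr x t * Lrepr x t)).
Proof.
move=> mA; have int1 := @integrable_bounded_mul _ _ _ (mrestr (lebesgue R n) mOmega)
  \1_A 1 x x _ _.
have {}int1 : (mrestr (lebesgue R n) mOmega).-integrable [set: Rn R n]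
    (EFin \o (fun t => \1_A t * (Lrepr x t * Lrepr x t))).
  apply: int1; first exact: measurable_indic.
  by move=> t; rewrite indicE; case: (t \in A); rewrite ?normr1 ?normr0.
split => //; rewrite -(Rintegral_mrestr int1) Rintegral_mkcondr.
apply: eq_Rintegral => t _; rewrite patchE indicE.
by case: ifP => _; rewrite ?mul1r ?mul0r // real_normK ?num_real // expr2.
Qed.

Variables (S : set (Rn R n)) (alpha : R).
Hypotheses (mS : measurable S) (S_sub : S `<=` Omega) (alpha_gt0 : 0 < alpha).

(** The function equal to alpha on S and to 1 off S. *)
Let weight (t : Rn R n) : R := 1 + (alpha - 1) * \1_S t.

Let measurable_weight : measurable_fun [set: Rn R n] weight.
Proof.
by apply: measurable_funD => //; apply: measurable_funM => //; exact: measurable_indic.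
Qed.

Let weight_le t : `|weight t| <= 1 + `|alpha - 1|.
Proof.
rewrite (le_trans (ler_normD _ _)) // normr1 lerD2l normrM ler_piMr //.
by rewrite indicE; case: (t \in S); rewrite ?normr1 ?normr0.
Qed.

Lemma weighted_normE x : weighted_norm S alpha x ^+ 2 =
  \int[mrestr (lebesgue R n) mOmega]_t (weight t * (Lrepr x t * Lrepr x t)).
Proof.
have [intS ES] := Rintegral_setI_sqr x mS.
have [intC EC] := Rintegral_setI_sqr x (measurableC mS).
rewrite sqr_sqrtr; last first.
  by rewrite addr_ge0 ?mulr_ge0 ?(ltW alpha_gt0) ?Rintegral_ge0 // => t _;
    rewrite sqr_ge0.
rewrite setDE -{1}(setIidr S_sub) ES EC -RintegralZl // -RintegralD //.
  apply: eq_Rintegral => t _; rewrite /weight !indicE in_setC.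
  by case: (t \in S) => /=; ring.
exact: (integrableZl measurableT alpha intS).
Qed.

Lemma weighted_norm_coercive x :
  Num.min alpha 1 * `|x| ^+ 2 <= weighted_norm S alpha x ^+ 2.
Proof.
have int2 := integrable_Lrepr2 x x.
rewrite weighted_normE -Lspace_dot_norm /Lspace_dot -RintegralZl //.
apply: le_Rintegral => //.
- exact: (integrableZl measurableT _ int2).
- exact: integrable_bounded_mul measurable_weight weight_le.
move=> t _; rewrite ler_wpM2r // -?expr2 ?sqr_ge0 // /weight indicE.
case: (t \in S); first by rewrite mulr1 addrC subrK ge_min lexx.
by rewrite mulr0 addr0 ge_min lexx orbT.
Qed.

(** With [W] the multiplication by the weight, all terms are values of the
    bilinear form <x, W z>, which is symmetric because it is the integral of
    weight * x * z. *)
Lemma weighted_norm_polar : exists W : L2 mOmega -> L2 mOmega, forall a x,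
  weighted_norm S alpha (a + x) ^+ 2 =
  weighted_norm S alpha a ^+ 2 + 2 * L2_dot x (W a) + weighted_norm S alpha x ^+ 2.
Proof.
have [W WE] := weight_multiplier (mrestr (lebesgue R n) mOmega)
  measurable_weight weight_le.
exists W => a x.
have E z : weighted_norm S alpha z ^+ 2 = L2_dot z (W z).
  by rewrite weighted_normE L2_dotE WE.
have C u v : L2_dot u (W v) = L2_dot v (W u).
  rewrite L2_dotE !WE; apply: eq_Rintegral => t _.
  by rewrite [Lrepr u t * _]mulrC.
rewrite !E linearDl /= (C a) (C x (a + x)) !linearDl /= (C a x); ring.
Qed.

End L2.

(** * The theorem *)

Theorem theoremA1 (R : realType) (n : nat)
  (Omega : set (Rn R n)) (mOmega : measurable Omega)
  (Omega_bounded : bounded_set (Omega : set 'rV[R]_n))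
  (Y : completeNormedModType R) (dotY : {dot Y for idfun})
  (dotY_norm : forall u : Y, dotY u u = `|u| ^+ 2)
  (D : set (L2 mOmega)) (F : L2 mOmega -> Y)
  (F_cont : {within D, continuous F})
  (F_closed : weakly_seq_closed (@L2_dot _ _ _ mOmega) dotY D F)
  (S : set (Rn R n)) (mS : measurable S) (S_sub : S `<=` Omega)
  (y : Y) (xdag xstar : L2 mOmega)
  (xstar_supp : supported_in S xstar)
  (xdag_min : minimizes_on
     [set x : L2 mOmega | [/\ D x, F x = y & supported_in S x]]
     (fun x => `|x - xstar|) xdag)
  (delta : R) (ydelta : Y) (ydelta_noise : `|ydelta - y| <= delta)
  (alpha : R) (alpha_gt0 : 0 < alpha)
  (y_ : nat -> Y) (y_cvg : y_ @ \oo --> ydelta)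
  (x_ : nat -> L2 mOmega)
  (x_min : forall k, minimizes_on D (tikhonov F xstar S alpha (y_ k)) (x_ k)) :
  (exists (phi : nat -> nat) (x : L2 mOmega),
     {homo phi : i j / (i < j)%N} /\ (x_ \o phi) @ \oo --> x)
  /\
  (forall (phi : nat -> nat) (x : L2 mOmega),
     {homo phi : i j / (i < j)%N} -> (x_ \o phi) @ \oo --> x ->
     minimizes_on D (tikhonov F xstar S alpha ydelta) x).
Proof.
have c0 : 0 < Num.min alpha 1 by rewrite lt_min alpha_gt0 ltr01.
have [W qD] := weighted_norm_polar mOmega mS S_sub alpha_gt0.
have stable := tikhonov_stability (@L2_dot_norm _ _ _ mOmega) dotY_norm F_closed qD c0
  (weighted_norm_coercive mS S_sub alpha_gt0).
split.
  by have [phi [x [phi_inc phix _]]] := stable xstar _ _ _ y_cvg x_min; exists phi, x.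
move=> phi x phi_inc phix.
(* A subsequence of (x_) consists of minimizers for the data y_ o phi, so it has
   a further subsequence that tends to a minimizer. *)
have yphi : (y_ \o phi) @ \oo --> ydelta := cvg_comp _ _ (increasing_cvgnyy phi_inc) y_cvg.
have [psi [x' [psi_inc psix' x'_min]]] :=
  stable xstar _ _ (x_ \o phi) yphi (fun k => x_min (phi k)).
suff -> : x = x' by [].
apply: norm_cvg_unique psix'.
exact: cvg_comp (increasing_cvgnyy psi_inc) phix.
Qed.
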